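(* Let $m\ge 1$, $0\le r<m$ and $s,\ell\ge 0$ be integers. There is a constant $C=C(s,\ell,m)>0$, depending only on $s$, $\ell$ and $m$, such that for every positive integer $n$ and every Sidon set $S=\{a_1<a_2<\cdots<a_t\}\subset[1,n]$ (so $t=|S|$) the following hold. (i) For every interval of integers $I\subset[1,n]$, $$\left|\sum_{\substack{1\le i\le t\\ a_i\in I\\ a_i\equiv r\ (\mathrm{mod}\ m)}} i^s a_i^\ell-\frac{t^{s+1}}{n^{s+1}}\sum_{\substack{a\in I\\ a\equiv r\ (\mathrm{mod}\ m)}}a^{s+\ell}\right|\le C\,t^s n^\ell\,\Phi(S,n)\log(2n).$$ (ii) In particular, $$\left|\sum_{\substack{1\le i\le t\\ a_i\equiv r\ (\mathrm{mod}\ m)}} i^s a_i^\ell-\frac{t^{s+1}}{m(s+\ell+1)}n^\ell\right|\le C\,t^s n^\ell\,\Phi(S,n)\log(2n).$$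
   Context: $[1,n]$ denotes $\{1,2,\ldots,n\}$. A set $S\subset\mathbb{Z}$ is a Sidon set if all sums $a+b$, with $(a,b)\in S^2$ regarded as unordered pairs (with $a=b$ allowed), are distinct; i.e. $a+b=c+d$ with $a,b,c,d\in S$ implies $\{a,b\}=\{c,d\}$. An interval of integers is a set of consecutive integers. The elements of $S$ are listed in increasing order, so $i$ is the rank of $a_i$ in $S$. For a Sidon set $S\subset[1,n]$ define $$\Phi(S,n)=n^{1/2}\left(\left|1-\frac{|S|}{n^{1/2}}\right|+n^{-1/4}\right)^{1/2}.$$ *)

(* Defs.v *)
From HB Require Import structures.
From mathcomp Require Import all_boot all_order all_algebra.
From mathcomp Require Import finmap.
From mathcomp Require Import all_classical all_reals all_analysis.

Set Implicit Arguments.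
Unset Strict Implicit.
Unset Printing Implicit Defensive.

Import Order.TTheory GRing.Theory Num.Theory.
Local Open Scope fset_scope.
Local Open Scope ring_scope.

Definition sidon (S : {fset int}) : Prop :=
  forall a b c d : int, a \in S -> b \in S -> c \in S -> d \in S ->
    a + b = c + d -> [fset a; b] = [fset c; d].

Definition sub_1n (S : {fset int}) (n : nat) : Prop :=
  forall x : int, x \in S -> 1 <= x <= n%:Z.

(* The empty set (u > v) counts as an interval. *)
Definition int_interval (I : {fset int}) : Prop :=
  exists u v : int, forall x : int, (x \in I) = (u <= x <= v).

(* a_i in S = {a_1 < ... < a_t}: ranks start at 1, hence the index i.-1;
   only meaningful for 1 <= i <= t. *)
Definition elt (S : {fset int}) (i : nat) : int :=
  nth 0 (sort <=%O (enum_fset S)) i.-1.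

Definition Phi (R : realType) (S : {fset int}) (n : nat) : R :=
  Num.sqrt n%:R *
  Num.sqrt (`|1 - #|` S|%:R / Num.sqrt n%:R| + n%:R `^ (- (4%:R^-1))).

(* Main.v *)
(* For a step m, let A(x) = |S \cap {x, x - m, ..., x - (u-1)m}|.  Since nonzero
   differences in S are not repeated, sum_x A(x)^2 <= u t + u^2, so A has small
   variance around tu/n.  Averaging A over a progression P contained in [1, n]
   gives u |S \cap P| up to boundary terms, each of which counts S in an interval
   of length at most um and is thus O(sqrt(um)).  Taking u ~ n^(3/4) yields
   |S \cap P| = (t/n) |P| + O(Phi).  With m = 1 this shows that the rank of a in S is
   ta/n + O(Phi); replacing the ranks by ta/n and summing by parts gives (i), and (ii)
   follows by evaluating the power sum over a residue class.  The factor ln(2n)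
   is only bounded below by ln 2. *)

Require Import Defs.
From HB Require Import structures.
From mathcomp Require Import all_boot all_order all_algebra.
From mathcomp Require Import finmap.
From mathcomp Require Import all_classical all_reals all_analysis.
From mathcomp Require Import zify ring lra.

Set Implicit Arguments.
Unset Strict Implicit.
Unset Printing Implicit Defensive.

Import Order.TTheory GRing.Theory Num.Theory.
Local Open Scope fset_scope.
Local Open Scope ring_scope.

(** * Shift correlations, energy and interval counts of Sidon predicates *)

Definition sidon_pred (chi : pred nat) : Prop :=
  forall a b c d, chi a -> chi b -> chi c -> chi d ->
    (a + b = c + d)%N -> a = c \/ a = d.

(** Truncated subtraction sends every [x <= d] to [0], where [f] vanishes; what remains is a
    translation. *)
Lemma sum_nat_subl (V : nmodType) (f : nat -> V) (d N : nat) : f 0%N = 0 ->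
  \sum_(0 <= x < N) f (x - d)%N = \sum_(0 <= x < N - d) f x.
Proof.
move=> f0; elim: N => [|N IH]; first by rewrite !big_geq.
rewrite big_nat_recr //= IH; case: (leqP d N) => dN.
  by rewrite subSn // big_nat_recr.
have -> : (N.+1 - d = N - d)%N by lia.
by rewrite (_ : (N - d)%N = 0%N) ?f0 ?addr0 //; lia.
Qed.

(* For [u > x + 1] the surplus terms are [f 0], by truncated subtraction. *)
Lemma sum_window (f : nat -> nat) (x u : nat) : f 0%N = 0%N ->
  (\sum_(0 <= j < u) f (x - j) = \sum_(x.+1 - u <= y < x.+1) f y)%N.
Proof.
move=> f0; elim: u => [|u IH]; first by rewrite !big_geq ?subn0.
rewrite big_nat_recr //= IH subSS; case: (leqP u x) => ux.
  by rewrite [RHS]big_ltn ?ltnS ?leq_subr // subSn // addnC.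
rewrite (_ : (x - u)%N = 0%N) ?f0 ?addn0; last by lia.
by rewrite (_ : (x.+1 - u)%N = 0%N) //; lia.
Qed.

Lemma sum_pred_le1 (P : pred nat) (N : nat) :
  (forall x y, P x -> P y -> x = y) -> (\sum_(0 <= x < N) P x <= 1)%N.
Proof.
move=> Puniq; elim: N => [|N IH]; first by rewrite big_geq.
rewrite big_nat_recr //=; case PN: (P N); last by rewrite addn0.
rewrite big_nat big1 // => x /andP[_ xN].
by case Px: (P x) => //; have := Puniq _ _ Px PN; lia.
Qed.

(** If [x] and [y] both contribute, then [(x - d) + (y - e) = (y - d) + (x - e)], so the Sidon
    property forces [x = y] or [d = e]. Since [chi] fails at [0], none of these subtractions is
    truncated. *)
Lemma sidon_shift_le1 (chi : pred nat) (d e N : nat) :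
  sidon_pred chi -> ~~ chi 0%N -> d != e ->
  (\sum_(0 <= x < N) chi (x - d) * chi (x - e) <= 1)%N.
Proof.
move=> sid chi0 de.
rewrite (eq_bigr (fun x => nat_of_bool (chi (x - d)%N && chi (x - e)%N))); last first.
  by move=> x _; rewrite mulnb.
apply: sum_pred_le1 => x y /andP[xd xe] /andP[yd ye].
have pos z : chi z -> (0 < z)%N by case: z => //; rewrite (negPf chi0).
have xd0 := pos _ xd; have xe0 := pos _ xe; have yd0 := pos _ yd; have ye0 := pos _ ye.
by have [] := sid _ _ _ _ xd ye yd xe ltac:(lia); lia.
Qed.

(* The off-diagonal terms of the expanded square are correlations at a fixed
   nonzero shift, each at most 1 by the Sidon property. *)
Lemma sidon_energy (chi : pred nat) (m u N : nat) : (0 < m)%N ->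
  sidon_pred chi -> ~~ chi 0%N ->
  (\sum_(0 <= x < N) (\sum_(0 <= j < u) chi (x - j * m)) ^ 2
     <= u * \sum_(0 <= x < N) chi x + u ^ 2)%N.
Proof.
move=> m0 sid chi0.
under eq_bigr => x _ do rewrite -mulnn big_distrlr /=.
rewrite exchange_big /=.
under eq_bigr => j _ do rewrite exchange_big /=.
set T := (\sum_(0 <= x < N) chi x)%N.
apply: (@leq_trans (\sum_(0 <= j < u) \sum_(0 <= i < u) ((i == j) * T + 1))%N).
  apply: leq_sum => j _; apply: leq_sum => i _.
  case: (eqVneq i j) => [->|ij]; last first.
    rewrite mul0n add0n; apply: sidon_shift_le1 => //.
    by rewrite eqn_pmul2r // eq_sym.
  rewrite mul1n addn1 ltnW // ltnS.
  rewrite (eq_bigr (fun x => nat_of_bool (chi (x - j * m)%N))); last first.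
    by move=> x _; rewrite mulnb andbb.
  have := @sum_nat_subl nat (fun x => nat_of_bool (chi x)) (j * m) N.
  rewrite (negPf chi0) => /(_ erefl) -> /=.
  rewrite /T (@big_cat_nat _ _ _ (N - j * m)%N 0 N) //= ?leq_subr //.
  exact: leq_addr.
rewrite big_nat (eq_bigr (fun=> (T + u)%N)); last first.
  move=> j /andP[_ ju]; rewrite big_split /= sum_nat_const_nat subn0 muln1.
  rewrite -big_distrl /=; congr (_ + _)%N.
  by rewrite big_mkord (bigD1 (Ordinal ju)) //= eqxx big1 ?mul1n // => i /negPf;
     rewrite -val_eqE /= => ->.
rewrite -big_nat sum_nat_const_nat subn0 mulnDr mulnn //.
Qed.

(** Apply the energy bound to the restriction of [chi] to [[p, q)], which has [b] elements: [N]
    windows of length [2N] see all of them, so [b^2 <= 2b + 4N]. With [N >= 1] this gives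
    [b^2 <= 12N]. *)
Lemma sidon_count_sqr (chi : pred nat) (p q N : nat) : (0 < N)%N ->
  sidon_pred chi -> ~~ chi 0%N -> (q <= p + N)%N ->
  ((\sum_(p <= x < q) chi x) ^ 2 <= 12 * N)%N.
Proof.
move=> N0 sid chi0 qpN; set b := (\sum_(p <= x < q) chi x)%N.
case: (leqP q p) => pq; first by rewrite /b big_geq //.
pose psi : pred nat := fun x => chi x && (p <= x < q)%N.
have sidp : sidon_pred psi.
  by move=> a b' c d /andP[ha _] /andP[hb _] /andP[hc _] /andP[hd _]; apply: sid.
have psi0 : ~~ psi 0%N by rewrite /psi (negPf chi0).
have sub y z : (y <= p)%N -> (q <= z)%N -> (\sum_(y <= x < z) psi x)%N = b.
  move=> yp qz; rewrite (@big_cat_nat _ _ _ p) //=; last by lia.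
  rewrite (@big_cat_nat _ _ _ q p z) //=; last by lia.
  rewrite big_nat big1 ?add0n => [|x xx]; last by rewrite /psi (_ : (p <= x)%N = false) ?andbF //; lia.
  rewrite [X in (_ + X)%N]big_nat [X in (_ + X)%N]big1 ?addn0 => [|x xx]; last first.
    by rewrite /psi (_ : (x < q)%N = false) ?andbF //; lia.
  by apply: eq_big_nat => x xx; rewrite /psi xx andbT.
(* Windows of length [2N] ending in [[p + N, p + 2N)] contain all of [[p, q)]. *)
have := @sidon_energy psi 1 (2 * N) (p + 2 * N) isT sidp psi0.
rewrite sub //; last by lia.
rewrite (@big_cat_nat _ _ _ (p + N)%N) //=; last by lia.
have : (N * b ^ 2 <= \sum_(p + N <= i < p + 2 * N) (\sum_(0 <= j < 2 * N) psi (i - j * 1)) ^ 2)%N.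
  have -> : (N * b ^ 2 = \sum_(p + N <= i < p + 2 * N) b ^ 2)%N.
    by rewrite sum_nat_const_nat; congr (_ * _)%N; lia.
  rewrite !big_nat; apply: leq_sum => x xx; rewrite leq_exp2r //.
  under eq_bigr => j _ do rewrite muln1.
  rewrite (@sum_window (fun x => nat_of_bool (psi x))) ?(negPf psi0) //.
  by rewrite sub //; lia.
move: (\sum_(p + N <= i < p + 2 * N) _)%N (\sum_(0 <= i < p + N) _)%N => X Y.
clearbody b; clear -N0; move=> h1 h2.
have h3 : (N * b ^ 2 <= N * (2 * b + 4 * N))%N by lia.
rewrite leq_pmul2l // in h3; nia.
Qed.

Lemma sidon_card_sqr (chi : pred nat) (n : nat) : (0 < n)%N ->
  sidon_pred chi -> ~~ chi 0%N -> ((\sum_(0 <= x < n.+1) chi x) ^ 2 <= 12 * n)%N.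
Proof.
move=> n0 sid chi0; rewrite big_ltn // (negPf chi0) add0n.
by apply: sidon_count_sqr; rewrite ?add1n.
Qed.

(** * Equidistribution of Sidon sets in progressions *)

Section Discrepancy.
Variable R : realType.
Implicit Types (chi : pred nat) (t n m : nat).

(** [Phi] depends on the set only through its cardinality, here the number [t]. *)
Definition Phit t n : R :=
  Num.sqrt n%:R * Num.sqrt (`|1 - t%:R / Num.sqrt n%:R| + n%:R `^ (- (4%:R^-1))).

(* The witness is [u] of order [n^(3/4)], which balances the terms [n t / u] and [u]
   of the variance bound. *)
Lemma Phit_window t n : (0 < n)%N -> (t ^ 2 <= 12 * n)%N ->
  exists u : nat, [/\ (0 < u)%N, 1 <= Phit t n,
    u%:R <= 2 * Phit t n ^+ 2,
    (n%:R * t%:R : R) <= 4 * u%:R * Phit t n ^+ 2 &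
    n%:R - t%:R ^+ 2 <= 5 * Phit t n ^+ 2].
Proof.
move=> n0 tn.
have n1 : (1 : R) <= n%:R by rewrite ler1n.
have n0R : (0 : R) < n%:R by rewrite ltr0n.
set x : R := Num.sqrt n%:R.
have x1 : 1 <= x by rewrite /x -[X in X <= _]sqrtr1 ler_sqrt.
have x0 : 0 < x by rewrite (lt_le_trans ltr01).
have xx : x ^+ 2 = n%:R by rewrite sqr_sqrtr ?ler0n.
set y : R := n%:R `^ (- (4%:R^-1)).
have y0 : 0 < y by rewrite powR_gt0.
have y1 : y <= 1 by rewrite -[X in _ <= X](powRr0 n%:R) ler_powR // oppr_le0 invr_ge0.
have yy : y ^+ 2 * x = 1.
  rewrite /y /x -powR12_sqrt ?ler0n // -powR_mulrn ?powR_ge0 // -powRrM.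
  rewrite -powRD; last by rewrite (gt_eqF n0R) implybT.
  by rewrite (_ : _ + _ = 0) ?powRr0 //; field.
have Q0 : 0 <= `|1 - t%:R / x| + y by rewrite addr_ge0 ?normr_ge0 ?ltW.
have PQ : Phit t n ^+ 2 = n%:R * (`|1 - t%:R / x| + y).
  by rewrite /Phit exprMn xx sqr_sqrtr.
have PQv : n%:R * y <= Phit t n ^+ 2.
  by rewrite PQ ler_pM2l // lerDr normr_ge0.
have v1 : 1 <= n%:R * y.
  rewrite -xx; have -> : x ^+ 2 * y = x * (x * y) by ring.
  have xy : 1 <= x * y by rewrite -[X in X <= _]yy expr2 -mulrA [y * x]mulrC ler_piMl ?mulr_ge0 ?(ltW x0) ?(ltW y0).
  by rewrite -[X in X <= _]mulr1 ler_pM.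
have tx : t%:R <= 4 * x.
  rewrite -(@ler_pXn2r _ 2) ?nnegrE ?ler0n //; last by rewrite mulr_ge0 ?ltW.
  have : (t%:R : R) ^+ 2 <= 12%:R * n%:R by rewrite -natrX -natrM ler_nat.
  rewrite exprMn xx; lra.
have P0 : 0 <= Phit t n by rewrite mulr_ge0 ?sqrtr_ge0.
pose u := (Num.truncn (n%:R * y)).+1; exists u.
have v0 : 0 <= n%:R * y by rewrite (le_trans _ v1).
have uv : n%:R * y <= u%:R by rewrite ltW // truncnS_gt.
have vu : u%:R <= 2 * (n%:R * y).
  have : (Num.truncn (n%:R * y))%:R <= n%:R * y by rewrite truncn_le.
  rewrite /u -natr1; lra.
split => //.
- by rewrite -(@ler_pXn2r _ 2) ?nnegrE ?ler01 // expr1n (le_trans v1).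
- by apply: (le_trans vu); rewrite ler_pM2l.
(* Here [y = n^(-1/4)], so [y^2 x = 1] and [4 (n y)^2 = 4 n x], which dominates [n t] because
   [t <= 4 x]. *)
- apply: (@le_trans _ _ (4 * (n%:R * y) * (n%:R * y))).
    have -> : 4 * (n%:R * y) * (n%:R * y) = n%:R * (4 * (x * (y ^+ 2 * x))) by rewrite -xx; ring.
    by rewrite yy mulr1 ler_pM2l.
  by apply: ler_pM => //; lra.
(* The factor [1 - t / x] is the deviation measured by [Phit]; the other factor is at most [5]. *)
- have -> : n%:R - t%:R ^+ 2 = n%:R * ((1 - t%:R / x) * (1 + t%:R / x)).
    by rewrite -xx; field; rewrite gt_eqF.
  rewrite PQ [5 * _]mulrCA ler_pM2l //.
  have tx4 : t%:R / x <= 4 by rewrite ler_pdivrMr.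
  have tx0 : 0 <= t%:R / x by rewrite divr_ge0 ?ler0n ?ltW.
  apply: (@le_trans _ _ (`|1 - t%:R / x| * 5)).
    apply: (@le_trans _ _ (`|1 - t%:R / x| * (1 + t%:R / x))).
      by rewrite ler_wpM2r ?ler_norm //; lra.
    by rewrite ler_wpM2l ?normr_ge0 //; lra.
  by rewrite mulrC ler_pM2l // lerDl ltW.
Qed.

(** The range of [x] extends past [n + (u - 1) m], so no shift loses an element and each is counted
    [u] times. *)
Lemma window_total chi m u n : ~~ chi 0%N -> (forall x, chi x -> x <= n)%N ->
  (\sum_(0 <= x < n + u * m + 1) \sum_(0 <= j < u) chi (x - j * m)
   = u * \sum_(0 <= x < n.+1) chi x)%N.
Proof.
move=> chi0 chin; rewrite exchange_big /= -[u in RHS]subn0 -sum_nat_const_nat.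
apply: eq_big_nat => j /andP[_ ju].
have jm : (j * m <= u * m)%N by rewrite leq_mul2r ltnW ?orbT.
have := @sum_nat_subl nat (fun x => nat_of_bool (chi x)) (j * m) (n + u * m + 1).
rewrite (negPf chi0) => /(_ erefl) -> /=.
rewrite (@big_cat_nat _ _ _ n.+1) //=; last by lia.
rewrite [X in (_ + X)%N = _]big_nat [X in (_ + X)%N = _]big1 ?addn0 // => x xx.
by case cx: (chi x) => //; have := chin _ cx; lia.
Qed.

(** Expand the square, with the second moment from [sidon_energy] and the first from [window_total].
    The range has [u m + 1] more points than [n]; each adds [mu^2 <= 12 u^2 / n], whence the last
    term. *)
Lemma window_variance chi m u n t : (0 < n)%N -> (0 < m)%N ->
  sidon_pred chi -> ~~ chi 0%N -> (forall x, chi x -> x <= n)%N ->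
  t = (\sum_(0 <= x < n.+1) chi x)%N ->
  n%:R * \sum_(0 <= x < n + u * m + 1)
     ((\sum_(0 <= j < u) chi (x - j * m))%N%:R - t%:R * u%:R / n%:R) ^+ 2
  <= n%:R * u%:R * t%:R + u%:R ^+ 2 * (n%:R - t%:R ^+ 2)
     + 12 * u%:R ^+ 2 * (u%:R * m%:R + 1) :> R.
Proof.
move=> n0 m0 sid chi0 chin tE.
have n0R : (0 : R) < n%:R by rewrite ltr0n.
pose A x := (\sum_(0 <= j < u) chi (x - j * m))%N.
set X := (n + u * m + 1)%N; set mu : R := _ / _.
have E1 : (\sum_(0 <= x < X) (A x)%:R : R) = u%:R * t%:R.
  by rewrite -natr_sum -natrM tE /X window_total.
have E2 : \sum_(0 <= x < X) (A x)%:R ^+ 2 <= u%:R * t%:R + u%:R ^+ 2 :> R.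
  under eq_bigr => x _ do rewrite -natrX.
  rewrite -natr_sum -natrX -natrM -natrD ler_nat.
  apply: (leq_trans (sidon_energy u X m0 sid chi0)).
  rewrite leq_add2r leq_mul2l; apply/orP; right.
  rewrite tE /X (@big_cat_nat _ _ _ n.+1) //=; last by lia.
  rewrite [X in (_ + X)%N]big_nat [X in (_ + X)%N]big1 ?addn0 // => x xx.
  by case cx: (chi x) => //; have := chin _ cx; lia.
have t2 : t%:R ^+ 2 <= 12 * n%:R :> R.
  by rewrite -natrX -natrM ler_nat tE sidon_card_sqr.
have -> : \sum_(0 <= x < X) ((A x)%:R - mu) ^+ 2 =
    \sum_(0 <= x < X) (A x)%:R ^+ 2 - 2 * mu * (u%:R * t%:R) + X%:R * mu ^+ 2.
  under eq_bigr => x _ do rewrite sqrrB.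
  rewrite !big_split /= sumr_const_nat subn0 -[mu ^+ 2 *+ X]mulr_natl; congr (_ + _ + _).
  rewrite sumrN -E1 mulr_sumr; congr (- _); apply: eq_bigr => x _.
  by rewrite -mulr_natl; ring.
have -> : X%:R = n%:R + (u%:R * m%:R + 1) :> R by rewrite /X !natrD natrM; ring.
have h : n%:R * \sum_(0 <= x < X) (A x)%:R ^+ 2 <= n%:R * (u%:R * t%:R + u%:R ^+ 2) :> R.
  by rewrite ler_pM2l.
rewrite !mulrDr !mulrN.
have -> : n%:R * (2 * mu * (u%:R * t%:R)) = 2 * (t%:R ^+ 2 * u%:R ^+ 2) :> R.
  by rewrite /mu; field; rewrite gt_eqF.
have -> : n%:R * ((n%:R + (u%:R * m%:R + 1)) * mu ^+ 2) =
    t%:R ^+ 2 * u%:R ^+ 2 + (t%:R ^+ 2 / n%:R) * (u%:R ^+ 2 * (u%:R * m%:R + 1)).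
  by rewrite /mu; field; rewrite gt_eqF.
have : (t%:R ^+ 2 / n%:R) * (u%:R ^+ 2 * (u%:R * m%:R + 1)) <=
    12 * (u%:R ^+ 2 * (u%:R * m%:R + 1)) :> R.
  by rewrite ler_wpM2r ?ler_pdivrMr.
lra.
Qed.

(** After multiplication by [u], replace [u] copies of [chi x] by the window count [A x]. The
    variance bounds the averaged sum by [23 m u P], where [23 = (45 + 1) / 2], and each of the [u]
    shifts costs a boundary error [5 m P]; the total is [28 m u P]. *)
Lemma sidon_discrepancy chi (m r n t p q : nat) : (0 < n)%N -> (0 < m)%N ->
  sidon_pred chi -> ~~ chi 0%N -> (forall x, chi x -> x <= n)%N ->
  t = (\sum_(0 <= x < n.+1) chi x)%N -> (0 < p <= q)%N -> (q <= n.+1)%N ->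
  `|\sum_(p <= x < q) (x %% m == r)%N%:R * ((chi x)%:R - t%:R / n%:R)|
   <= 28 * m%:R * Phit t n.
Proof.
move=> n0 m0 sid chi0 chin tE /andP[p0 pq] qn.
have n0R : (0 : R) < n%:R by rewrite ltr0n.
have m1R : (1 : R) <= m%:R by rewrite ler1n.
have t2 : (t ^ 2 <= 12 * n)%N by rewrite tE sidon_card_sqr.
have [u [u0 P1 uP ntP ntP']] := Phit_window n0 t2.
set P := Phit t n in P1 uP ntP ntP' *.
have P0 : 0 < P by rewrite (lt_le_trans ltr01).
have u0R : (0 : R) < u%:R by rewrite ltr0n.
pose A x := (\sum_(0 <= j < u) chi (x - j * m))%N.
pose mu : R := t%:R * u%:R / n%:R.
pose E x : R := (x %% m == r)%N%:R.
have E01 x : 0 <= E x <= 1 by rewrite /E; case: (_ == _); rewrite ?lexx ?ler01.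
pose V := \sum_(0 <= x < n + u * m + 1) ((A x)%:R - mu) ^+ 2.
(* The constant is [4 + 5 + 12 * 3], using [u <= 2 P^2] and [P, m >= 1]. *)
have VP : n%:R * V <= 45 * m%:R * (u%:R ^+ 2 * P ^+ 2).
  apply: (le_trans (window_variance u n0 m0 sid chi0 chin tE)).
  have h1 : u%:R * (n%:R * t%:R) <= u%:R * (4 * u%:R * P ^+ 2) by rewrite ler_pM2l.
  have h2 : u%:R ^+ 2 * (n%:R - t%:R ^+ 2) <= u%:R ^+ 2 * (5 * P ^+ 2).
    by rewrite ler_pM2l ?exprn_gt0.
  have h3 : u%:R ^+ 2 * (u%:R * m%:R + 1) <= u%:R ^+ 2 * (3 * m%:R * P ^+ 2).
    rewrite ler_pM2l ?exprn_gt0 //.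
    have a1 : u%:R * m%:R <= 2 * P ^+ 2 * m%:R by rewrite ler_wpM2r.
    have a2 : 1 * 1 <= m%:R * P ^+ 2 by rewrite ler_pM // exprn_ege1.
    lra.
  have h4 : u%:R ^+ 2 * P ^+ 2 <= m%:R * (u%:R ^+ 2 * P ^+ 2).
    by rewrite ler_peMl // mulr_ge0 ?exprn_ge0 ?ltW.
  lra.
have main : `|\sum_(p <= x < q) E x * ((A x)%:R - mu)| <= 23 * m%:R * (u%:R * P).
  (* AM-GM: [2 |y| <= y^2 / lam + lam]; this [lam] balances the two resulting sums. *)
  pose lam := u%:R * P / n%:R.
  have lam0 : 0 < lam by rewrite divr_gt0 // mulr_gt0.
  have step x : `|E x * ((A x)%:R - mu)| <= (((A x)%:R - mu) ^+ 2 / lam + lam) / 2.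
    set y := _ - mu; rewrite normrM (ger0_norm (proj1 (andP (E01 x)))).
    apply: (@le_trans _ _ `|y|); first by rewrite ler_piMl ?(proj2 (andP (E01 x))).
    rewrite ler_pdivlMr // -(ler_pM2r lam0) mulrDl divfK ?gt_eqF //.
    rewrite -(real_normK (num_real y)).
    have := sqr_ge0 (`|y| - lam); lra.
  apply: (le_trans (ler_norm_sum _ _ _)).
  apply: (@le_trans _ _ (\sum_(p <= x < q) (((A x)%:R - mu) ^+ 2 / lam + lam) / 2)).
    exact: ler_sum.
  rewrite -mulr_suml big_split /= -mulr_suml sumr_const_nat -mulr_natl.
  have hV : \sum_(p <= x < q) ((A x)%:R - mu) ^+ 2 <= V.
    rewrite /V (@big_cat_nat _ _ _ p 0 (n + u * m + 1)) //=; last by lia.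
    rewrite (@big_cat_nat _ _ _ q p (n + u * m + 1)) //=; last by lia.
    rewrite addrCA lerDl addr_ge0 // sumr_ge0 // => x _; exact: sqr_ge0.
  have hq : (q - p)%:R <= n%:R :> R by rewrite ler_nat; lia.
  have h1 : (\sum_(p <= x < q) ((A x)%:R - mu) ^+ 2) / lam <= 45 * m%:R * (u%:R * P).
    rewrite ler_pdivrMr //; apply: (le_trans hV).
    rewrite -(ler_pM2l n0R); apply: (le_trans VP).
    rewrite /lam le_eqVlt; apply/orP; left; apply/eqP; field.
    by rewrite gt_eqF.
  have h2 : (q - p)%:R * lam <= u%:R * P.
    by rewrite /lam mulrCA ler_piMr ?mulr_ge0 ?(ltW P0) // ler_pdivrMr // mul1r.
  have h3 : u%:R * P <= m%:R * (u%:R * P) by rewrite ler_peMl // mulr_ge0 ?ltW.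
  lra.
pose e x : nat := chi x && (x %% m == r)%N.
have e0 : e 0%N = 0%N by rewrite /e (negPf chi0).
(* Shifting by a multiple of [m] preserves the residue class; a truncated shift lands on [0], where
   both sides vanish. *)
have eshift j x : E x * (chi (x - j * m)%N)%:R = (e (x - j * m)%N)%:R.
  rewrite /E /e -natrM mulnb andbC; case cx: (chi _) => //=.
  case: (leqP (j * m) x) => jx; last by move: cx; rewrite (_ : (_ - _)%N = 0%N) ?(negPf chi0) //; lia.
  by rewrite -{1}(subnK jx) addnC modnMDl.
(* By [sidon_count_sqr] the squared count is at most [12 u m <= 24 m P^2 <= (5 m P)^2]. *)
have tail z d : (d <= u * m)%N -> ((\sum_(z - d <= x < z) e x)%:R : R) <= 5 * m%:R * P.
  move=> du.
  have um0 : (0 < u * m)%N by rewrite muln_gt0 u0.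
  have := @sidon_count_sqr chi (z - d) z (u * m) um0 sid chi0 ltac:(lia).
  have le : (\sum_(z - d <= x < z) e x <= \sum_(z - d <= x < z) chi x)%N.
    by apply: leq_sum => x _; rewrite /e; case: (chi x) => //=; case: (_ == _).
  rewrite -(ler_nat R) natrX !natrM => h.
  apply: (@le_trans _ _ ((\sum_(z - d <= x < z) chi x)%:R)); first by rewrite ler_nat.
  rewrite -(@ler_pXn2r _ 2) ?nnegrE ?ler0n ?mulr_ge0 ?(ltW P0) //.
  apply: (le_trans h).
  have a1 : u%:R * m%:R <= 2 * P ^+ 2 * m%:R by rewrite ler_wpM2r.
  have a2 : m%:R * P ^+ 2 <= m%:R * (m%:R * P ^+ 2).
    by rewrite ler_peMl // mulr_ge0 ?exprn_ge0 ?(ltW P0).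
  have a3 : 0 <= m%:R * P ^+ 2 by rewrite mulr_ge0 ?exprn_ge0 ?(ltW P0).
  rewrite (_ : _ ^+ 2 = 25 * (m%:R * (m%:R * P ^+ 2))); last by ring.
  lra.
(* The sum telescopes to a difference of two boundary counts. Both are nonnegative, so a bound for
   one of them suffices. *)
have shift j : (j < u)%N ->
    `|\sum_(p <= x < q) ((e x)%:R - (e (x - j * m)%N)%:R)| <= 5 * m%:R * P.
  move=> ju; have jm : (j * m <= u * m)%N by rewrite leq_mul2r ltnW ?orbT.
  have c z : (\sum_(0 <= x < z) (e x)%:R - \sum_(0 <= x < z) (e (x - j * m)%N)%:R : R)
      = (\sum_(z - j * m <= x < z) e x)%:R.
    rewrite (@sum_nat_subl R (fun x => (e x)%:R)) ?e0 //.
    rewrite (@big_cat_nat _ _ _ (z - j * m)%N 0 z) //= ?leq_subr //.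
    by rewrite addrC addrK natr_sum.
  have -> : \sum_(p <= x < q) ((e x)%:R - (e (x - j * m)%N)%:R) =
     (\sum_(q - j * m <= x < q) e x)%:R - (\sum_(p - j * m <= x < p) e x)%:R :> R.
    rewrite -!c sumrB (@big_cat_nat _ _ _ p 0 q) //=.
    by rewrite (@big_cat_nat _ _ _ p 0 q (fun=> true) (fun x => (e (x - j * m)%N)%:R)) //=; ring.
  rewrite ler_norml; have := tail q _ jm; have := tail p _ jm.
  have := ler0n R (\sum_(q - j * m <= x < q) e x).
  have := ler0n R (\sum_(p - j * m <= x < p) e x).
  lra.
rewrite -(ler_pM2l u0R) -{1}(ger0_norm (ltW u0R)) -normrM.
have -> : u%:R * (\sum_(p <= x < q) E x * ((chi x)%:R - t%:R / n%:R)) =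
    \sum_(p <= x < q) E x * ((A x)%:R - mu)
    + \sum_(0 <= j < u) \sum_(p <= x < q) ((e x)%:R - (e (x - j * m)%N)%:R).
  rewrite exchange_big /= -big_split /= mulr_sumr; apply: eq_bigr => x _.
  have -> : \sum_(0 <= j < u) ((e x)%:R - (e (x - j * m)%N)%:R)
    = u%:R * (e x)%:R - E x * (A x)%:R :> R.
    rewrite sumrB sumr_const_nat subn0 mulr_natl natr_sum mulr_sumr.
    by congr (_ - _); apply: eq_bigr => j _; rewrite eshift.
  have := eshift 0%N x; rewrite mul0n subn0 => <-.
  by rewrite /mu; ring.
apply: (le_trans (ler_normD _ _)).
have : `|\sum_(0 <= j < u) \sum_(p <= x < q) ((e x)%:R - (e (x - j * m)%N)%:R)|
   <= u%:R * (5 * m%:R * P).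
  apply: (le_trans (ler_norm_sum _ _ _)).
  have -> : u%:R * (5 * m%:R * P) = \sum_(0 <= j < u) (5 * m%:R * P).
    by rewrite sumr_const_nat subn0 mulr_natl.
  by rewrite !big_nat; apply: ler_sum => j /andP[_ ju]; exact: shift.
lra.
Qed.

End Discrepancy.

(** * Summation by parts and power sums *)

Section PowerSums.
Variable R : realFieldType.

(** Write [g x] as [g p] plus increments: each nonnegative increment multiplies a tail sum of [w],
    at most [B] in absolute value, and the increments add up to [g q - g p]. *)
Lemma abel_le (w g : nat -> R) (B : R) (p q : nat) : (p <= q)%N ->
  (forall i, (p <= i <= q)%N -> `|\sum_(i <= x < q) w x| <= B) ->
  {homo g : x y / (x <= y)%N >-> x <= y} -> 0 <= g p ->
  `|\sum_(p <= x < q) w x * g x| <= B * g q.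
Proof.
move=> pq wB gh gp0.
have diff d : (d <= q - p)%N ->
    `|\sum_(q - d <= x < q) w x * (g x - g (q - d)%N)| <= B * (g q - g (q - d)%N).
  elim: d => [|d IH] dq; first by rewrite subn0 big_geq // subrr mulr0 normr0.
  have E : (q - d = (q - d.+1).+1)%N by lia.
  rewrite big_ltn; last by lia.
  rewrite subrr mulr0 add0r -E.
  have -> : \sum_(q - d <= x < q) w x * (g x - g (q - d.+1)%N)
     = \sum_(q - d <= x < q) w x * (g x - g (q - d)%N)
       + (\sum_(q - d <= x < q) w x) * (g (q - d)%N - g (q - d.+1)%N).
    by rewrite mulr_suml -big_split /=; apply: eq_bigr => x _; ring.
  apply: (le_trans (ler_normD _ _)); rewrite normrM.
  have gd : 0 <= g (q - d)%N - g (q - d.+1)%N by rewrite subr_ge0 gh //; lia.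
  rewrite (ger0_norm gd).
  have h1 := IH ltac:(lia).
  have h2 : `|\sum_(q - d <= x < q) w x| * (g (q - d)%N - g (q - d.+1)%N)
      <= B * (g (q - d)%N - g (q - d.+1)%N) by rewrite ler_wpM2r // wB //; lia.
  lra.
have := diff _ (leqnn _); rewrite subKn // => h1.
have -> : \sum_(p <= x < q) w x * g x =
    \sum_(p <= x < q) w x * (g x - g p) + (\sum_(p <= x < q) w x) * g p.
  by rewrite mulr_suml -big_split /=; apply: eq_bigr => x _; ring.
apply: (le_trans (ler_normD _ _)); rewrite normrM (ger0_norm gp0).
have h2 : `|\sum_(p <= x < q) w x| * g p <= B * g p.
  by rewrite ler_wpM2r // wB // leqnn.
lra.
Qed.

(** The factor [2 ^+ k] comes from [q <= n + 1 <= 2 n]. *)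
Lemma abel_pow_le (w : nat -> R) (B : R) (k n p q : nat) : (0 < n)%N ->
  (p <= q)%N -> (q <= n.+1)%N -> 0 <= B ->
  (forall i, (p <= i <= q)%N -> `|\sum_(i <= x < q) w x| <= B) ->
  `|\sum_(p <= x < q) w x * x%:R ^+ k| <= B * (2 ^+ k * n%:R ^+ k).
Proof.
move=> n0 pq qn B0 wB.
apply: (le_trans (@abel_le w (fun x => x%:R ^+ k) B p q pq wB _ _)).
- by move=> x y xy; rewrite lerXn2r ?nnegrE ?ler0n // ler_nat.
- by rewrite exprn_ge0.
rewrite ler_wpM2l // -exprMn lerXn2r ?nnegrE ?mulr_ge0 // -natrM ler_nat; lia.
Qed.

(** The mean value theorem for powers, by induction on the exponent. *)
Lemma expr_sub_bounds (x y : R) (k : nat) : 0 <= y -> y <= x ->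
  k.+1%:R * y ^+ k * (x - y) <= x ^+ k.+1 - y ^+ k.+1 <= k.+1%:R * x ^+ k * (x - y).
Proof.
move=> y0 yx; have x0 := le_trans y0 yx.
elim: k => [|k /andP[IH1 IH2]]; first by rewrite !expr0 !expr1 !mulr1 !mul1r lexx.
have yk : y ^+ k.+1 * (x - y) <= x ^+ k.+1 * (x - y).
  by rewrite ler_wpM2r ?subr_ge0 // lerXn2r.
have h1 : y * (k.+1%:R * y ^+ k * (x - y)) <= y * (x ^+ k.+1 - y ^+ k.+1).
  by rewrite ler_wpM2l.
have h2 : x * (x ^+ k.+1 - y ^+ k.+1) <= x * (k.+1%:R * x ^+ k * (x - y)).
  by rewrite ler_wpM2l.
rewrite -[k.+2%:R]natr1 ![_ ^+ k.+2]exprS.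
have e1 := exprS x k; have e2 := exprS y k.
apply/andP; split.
  have -> : (k.+1%:R + 1) * y ^+ k.+1 * (x - y) =
     y * (k.+1%:R * y ^+ k * (x - y)) + y ^+ k.+1 * (x - y) by rewrite e2; ring.
  lra.
have -> : (k.+1%:R + 1) * x ^+ k.+1 * (x - y) =
   x * (k.+1%:R * x ^+ k * (x - y)) + x ^+ k.+1 * (x - y) by rewrite e1; ring.
lra.
Qed.

(** The factor [M] on the left keeps the exponent [k] on the right, so that [k = 0] and [M = 0] need
    no separate form. *)
Lemma expr_lipschitz (x y M : R) (k : nat) : 0 <= x <= M -> 0 <= y <= M ->
  M * `|x ^+ k - y ^+ k| <= k%:R * M ^+ k * `|x - y|.
Proof.
case: k => [|k]; first by rewrite !expr0 subrr normr0 mulr0 !mul0r.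
wlog yx : x y / y <= x => [th|/andP[x0 xM] /andP[y0 yM]].
  move=> hx hy; case: (leP y x) => [|/ltW] h; first exact: th.
  by rewrite distrC (distrC x); apply: th.
have M0 := le_trans x0 xM.
rewrite !ger0_norm ?subr_ge0 ?lerXn2r ?nnegrE //.
have /andP[_ h] := expr_sub_bounds k y0 yx.
have -> : k.+1%:R * M ^+ k.+1 * (x - y) = M * (k.+1%:R * M ^+ k * (x - y)).
  by rewrite exprS; ring.
rewrite ler_wpM2l // (le_trans h) // ler_wpM2r ?subr_ge0 // ler_wpM2l //.
by rewrite lerXn2r.
Qed.

(** Telescope [expr_sub_bounds] over consecutive integers. *)
Lemma sum_pow_bounds (k n : nat) :
  (n%:R : R) ^+ k.+1 <= k.+1%:R * \sum_(1 <= x < n.+1) (x%:R : R) ^+ k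
    <= n%:R ^+ k.+1 + k.+1%:R * n%:R ^+ k.
Proof.
elim: n => [|n /andP[IH1 IH2]].
  by rewrite big_geq // mulr0 expr0n lexx /= add0r mulr_ge0 ?exprn_ge0.
rewrite big_nat_recr //= mulrDr.
have := @expr_sub_bounds n.+1%:R n%:R k (ler0n _ _).
rewrite ler_nat leqnSn => /(_ isT) /andP[].
have -> : n.+1%:R - n%:R = 1 :> R by rewrite -natr1; ring.
rewrite !mulr1; lra.
Qed.

(** With the offset [m.-1 - r], the quotient increases from [N] to [N + 1] exactly when [N] is
    congruent to [r]. *)
Lemma sum_residue (m r N : nat) : (r < m)%N ->
  (\sum_(0 <= x < N) (x %% m == r) = (N + (m.-1 - r)) %/ m)%N.
Proof.
move=> rm; have m0 : (0 < m)%N by lia.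
elim: N => [|N IH]; first by rewrite big_geq // divn_small //; lia.
rewrite big_nat_recr //= IH addSn divnS // addnC; congr (nat_of_bool _ + _)%N.
have -> : (N + (m.-1 - r)).+1 = (N + (m - r))%N by lia.
have -> : (N %% m == r)%N = (N == r %[mod m])%N by rewrite (modn_small rm).
by rewrite -(eqn_modDr (m - r)) subnKC ?modnn // ltnW.
Qed.

(** The sum is a difference of two fractional parts. *)
Lemma residue_discrepancy (m r p q : nat) : (r < m)%N -> (p <= q)%N ->
  `|\sum_(p <= x < q) ((x %% m == r)%N%:R - m%:R^-1)| <= 1 :> R.
Proof.
move=> rm pq; have m0 : (0 < m)%N by lia.
have m0R : (0 : R) < m%:R by rewrite ltr0n.
have c : \sum_(p <= x < q) (x %% m == r)%N%:R =
   ((q + (m.-1 - r)) %/ m)%N%:R - ((p + (m.-1 - r)) %/ m)%N%:R :> R.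
  rewrite -!sum_residue // (@big_cat_nat _ _ _ p 0 q) //= natrD.
  by rewrite [X in X - _]addrC addrK natr_sum.
rewrite sumrB c sumr_const_nat -[_^-1 *+ _]mulr_natl natrB //.
set k := (m.-1 - r)%N.
have fl z : ((z + k) %/ m)%N%:R * m%:R <= z%:R + k%:R :> R.
  by rewrite -natrM -natrD ler_nat leq_divM.
have fu z : z%:R + k%:R <= (((z + k) %/ m)%N%:R + 1) * m%:R :> R.
  by rewrite natr1 -natrM -natrD ler_nat ltnW // ltn_ceil.
set X := (X in `|X|).
have Xm : X * m%:R = ((q + k) %/ m)%N%:R * m%:R - ((p + k) %/ m)%N%:R * m%:R - (q%:R - p%:R).
  by rewrite /X !mulrBl !divfK ?gt_eqF.
have := fl p; have := fl q; have := fu p; have := fu q; rewrite !mulrDl mul1r.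
by rewrite ler_norml; move=> *; apply/andP; split; rewrite -(ler_pM2r m0R) Xm; lra.
Qed.

(** Split the indicator of the class into its density [1 / m] and a remainder with bounded partial
    sums. The density part errs by at most [n^k], the remainder contributes at most [2^k n^k] by
    Abel summation. *)
Lemma sum_pow_residue (m r k n : nat) : (r < m)%N -> (0 < n)%N ->
  `|\sum_(1 <= x < n.+1) (x %% m == r)%N%:R * x%:R ^+ k
     - n%:R ^+ k.+1 / (m%:R * k.+1%:R)| <= (2 ^+ k + 1) * n%:R ^+ k :> R.
Proof.
move=> rm n0; have m0 : (0 < m)%N by lia.
have m0R : (0 : R) < m%:R by rewrite ltr0n.
have m1R : (1 : R) <= m%:R by rewrite ler1n.
have k0R : (0 : R) < k.+1%:R by rewrite ltr0n.
have := @abel_pow_le (fun x => (x %% m == r)%N%:R - m%:R^-1) 1 k n 1 n.+1 n0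
  isT (leqnn _) ler01.
have bd i : (1 <= i <= n.+1)%N ->
   `|\sum_(i <= x < n.+1) ((x %% m == r)%N%:R - m%:R^-1)| <= 1 :> R.
  by move=> /andP[_ ?]; exact: residue_discrepancy.
move=> /(_ bd); rewrite mul1r => h.
have /andP[h1 h2] := sum_pow_bounds k n.
set T := \sum_(_ <= _ < _) _ in h1 h2.
have hT : `|m%:R^-1 * T - n%:R ^+ k.+1 / (m%:R * k.+1%:R)| <= n%:R ^+ k.
  have -> : m%:R^-1 * T - n%:R ^+ k.+1 / (m%:R * k.+1%:R) =
     (m%:R^-1) * (k.+1%:R^-1 * (k.+1%:R * T - n%:R ^+ k.+1)).
    by field; rewrite !gt_eqF.
  rewrite normrM ger0_norm ?invr_ge0 // ger0_norm; last first.
    by rewrite mulr_ge0 ?invr_ge0 // subr_ge0.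
  rewrite ler_pdivrMl // ler_pdivrMl // mulrCA.
  have : k.+1%:R * n%:R ^+ k <= m%:R * (k.+1%:R * n%:R ^+ k) :> R.
    by rewrite ler_peMl // mulr_ge0 ?exprn_ge0.
  lra.
have E : \sum_(1 <= x < n.+1) (x %% m == r)%N%:R * x%:R ^+ k
  = \sum_(1 <= x < n.+1) ((x %% m == r)%N%:R - m%:R^-1) * x%:R ^+ k + m%:R^-1 * T :> R.
  by rewrite /T mulr_sumr -big_split /=; apply: eq_bigr => x _; ring.
rewrite E -addrA mulrDl mul1r.
by apply: (le_trans (ler_normD _ _)); apply: lerD.
Qed.

End PowerSums.

(** * Moments weighted by rank and value *)

Section Moments.
Variable R : realType.

Definition rank (chi : pred nat) (x : nat) : nat := (\sum_(0 <= y < x.+1) chi y)%N.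

(** First replace the rank by [t x / n], which costs the term with [28 s]; then replace [chi] by its
    density [t / n] under the monotone weight [x^(s + l)], which costs the term with
    [28 m 2^(s + l)]. *)
Lemma sidon_moment (chi : pred nat) (m r s l n t p q : nat) : (0 < n)%N -> (0 < m)%N ->
  sidon_pred chi -> ~~ chi 0%N -> (forall x, chi x -> x <= n)%N ->
  t = (\sum_(0 <= x < n.+1) chi x)%N -> (0 < p <= q)%N -> (q <= n.+1)%N ->
  `|\sum_(p <= x < q) (x %% m == r)%N%:R * (chi x)%:R * ((rank chi x)%:R ^+ s * x%:R ^+ l)
    - t%:R ^+ s.+1 / n%:R ^+ s.+1 *
      \sum_(p <= x < q) (x %% m == r)%N%:R * x%:R ^+ (s + l)|
  <= (28 * s%:R + 28 * m%:R * 2 ^+ (s + l)) * (t%:R ^+ s * n%:R ^+ l * Phit R t n).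
Proof.
move=> n0 m0 sid chi0 chin tE /andP[p0 pq] qn.
have n0R : (0 : R) < n%:R by rewrite ltr0n.
set P := Phit R t n.
have P0 : 0 <= P by rewrite mulr_ge0 ?sqrtr_ge0.
pose E x : R := (x %% m == r)%N%:R.
have E01 x : 0 <= E x <= 1 by rewrite /E; case: (_ == _); rewrite ?lexx ?ler01.
have chit p' q' : (q' <= n.+1)%N -> (\sum_(p' <= x < q') chi x <= t)%N.
  move=> q'n; case: (leqP p' q') => pq'; last by rewrite big_geq // ltnW.
  rewrite tE (@big_cat_nat _ _ _ p' 0 n.+1) //=; last exact: leq_trans q'n.
  by rewrite (@big_cat_nat _ _ _ q' p' n.+1) //=; lia.
(* This is the discrepancy bound with modulus [1] on [[1, x]]. *)
have rank_near x : (x <= n)%N ->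
    `|(rank chi x)%:R - t%:R * x%:R / n%:R| <= 28 * P.
  move=> xn; have := @sidon_discrepancy R chi 1 0 n t 1 x.+1 n0 isT sid chi0 chin tE isT xn.
  rewrite mulr1; congr (`|_| <= _).
  under eq_bigr => y _ do rewrite modn1 eqxx mul1r.
  rewrite sumrB sumr_const_nat subn1 /= -natr_sum -[_ *+ x]mulr_natl /rank.
  by rewrite [in RHS]big_ltn // (negPf chi0) add0n; field; rewrite gt_eqF.
pose D x : R := (rank chi x)%:R ^+ s - (t%:R * x%:R / n%:R) ^+ s.
have -> : \sum_(p <= x < q) E x * (chi x)%:R * ((rank chi x)%:R ^+ s * x%:R ^+ l)
    - t%:R ^+ s.+1 / n%:R ^+ s.+1 * \sum_(p <= x < q) E x * x%:R ^+ (s + l)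
  = \sum_(p <= x < q) E x * (chi x)%:R * (D x * x%:R ^+ l)
    + t%:R ^+ s / n%:R ^+ s *
      \sum_(p <= x < q) E x * ((chi x)%:R - t%:R / n%:R) * x%:R ^+ (s + l).
  rewrite !mulr_sumr -sumrB -big_split /=; apply: eq_bigr => x _.
  rewrite /D !exprMn exprVn !exprD !exprS.
  have alg (a b c d e f g y z : R) : a != 0 -> y != 0 ->
      e * g * (f * d) - z * b / (y * a) * (e * (c * d)) =
      e * g * ((f - b * c / a) * d) + b / a * (e * (g - z / y) * (c * d)).
    by move=> a0 y0; field; rewrite a0 y0.
  by apply: alg; rewrite ?expf_neq0 // gt_eqF.
apply: (le_trans (ler_normD _ _)); rewrite mulrDl; apply: lerD; last first.
  rewrite normrM ger0_norm ?divr_ge0 ?exprn_ge0 //.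
  have := @abel_pow_le R (fun x => E x * ((chi x)%:R - t%:R / n%:R)) (28 * m%:R * P) (s + l) n p q n0 pq qn.
  rewrite !mulr_ge0 // => /(_ isT) h.
  have {}h := h (fun i hi => @sidon_discrepancy R chi m r n t i q n0 m0 sid chi0 chin tE ltac:(lia) qn).
  have h2 : 0 <= t%:R ^+ s / n%:R ^+ s :> R by rewrite divr_ge0 ?exprn_ge0.
  apply: (le_trans (ler_wpM2l h2 h)).
  rewrite le_eqVlt; apply/orP; left; apply/eqP.
  by rewrite [n%:R ^+ (s + l)]exprD; field; rewrite expf_neq0 // gt_eqF.
apply: (le_trans (ler_norm_sum _ _ _)).
(* The Lipschitz bound on [[0, t]] yields a factor [1 / t] per element, cancelled by the at most [t]
   elements summed. For [t = 0] the inverse is [0], hence the case split at the end. *)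
pose G : R := 28 * s%:R * t%:R ^+ s * P / t%:R * n%:R ^+ l.
apply: (@le_trans _ _ (\sum_(p <= x < q) (chi x)%:R * G)).
  rewrite !big_nat; apply: ler_sum => x xx.
  case cx: (chi x); last by rewrite mulr0 !mul0r normr0.
  have xn : (x <= n)%N by lia.
  rewrite mulr1 mul1r normrM (ger0_norm (proj1 (andP (E01 x)))).
  apply: (@le_trans _ _ `|D x * x%:R ^+ l|).
    by rewrite ler_piMl ?(proj2 (andP (E01 x))).
  have t0 : (0 < t)%N.
    rewrite tE (@big_cat_nat _ _ _ x 0 n.+1) //=; last by lia.
    by rewrite (big_ltn (m := x)) ?cx ?ltnS //; lia.
  rewrite normrM (@ger0_norm _ (x%:R ^+ l)) ?exprn_ge0 // /G.
  apply: ler_pM; rewrite ?exprn_ge0 //; last first.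
    by rewrite lerXn2r ?nnegrE // ler_nat.
  rewrite ler_pdivlMr ?ltr0n // mulrC.
  apply: (@le_trans _ _ (s%:R * t%:R ^+ s * `|(rank chi x)%:R - t%:R * x%:R / n%:R|)).
    apply: expr_lipschitz.
      by rewrite ler0n ler_nat chit // ltnS.
    rewrite divr_ge0 ?mulr_ge0 //= ler_pdivrMr // ler_wpM2l //.
    by rewrite ler_nat.
  have -> : 28 * s%:R * t%:R ^+ s * P = s%:R * t%:R ^+ s * (28 * P) by ring.
  by rewrite ler_wpM2l ?mulr_ge0 ?exprn_ge0 // rank_near.
rewrite -mulr_suml -natr_sum.
have G0 : 0 <= G by rewrite /G !mulr_ge0 ?invr_ge0 ?exprn_ge0.
apply: (@le_trans _ _ (t%:R * G)); first by rewrite ler_wpM2r // ler_nat chit.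
rewrite /G; case: (posnP t) => [->|t0]; first by rewrite mul0r !mulr_ge0 ?exprn_ge0.
rewrite le_eqVlt; apply/orP; left; apply/eqP.
by field; rewrite gt_eqF ?ltr0n.
Qed.

End Moments.

(** * From sets of integers to predicates on naturals *)

Section Encoding.

Definition nat_mem (S : {fset int}) : pred nat := fun x => x%:Z \in S.

Lemma sidon_nat_mem (S : {fset int}) : sidon S -> sidon_pred (nat_mem S).
Proof.
move=> sid a b c d ha hb hc hd abcd.
have e : a%:Z + b%:Z = c%:Z + d%:Z by rewrite -!PoszD abcd.
have : a%:Z \in [fset c%:Z; d%:Z] by rewrite -(sid _ _ _ _ ha hb hc hd e) !inE eqxx.
by rewrite !inE => /orP[] /eqP[]; [left|right].
Qed.

Lemma sub_1n_enum (I : {fset int}) (n : nat) : sub_1n I n ->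
  perm_eq (enum_fset I) [seq x%:Z | x <- index_iota 1 n.+1 & nat_mem I x].
Proof.
move=> sub; apply: uniq_perm; first exact: fset_uniq.
  by rewrite map_inj_uniq ?filter_uniq ?iota_uniq // => x y [].
move=> a; apply/idP/mapP => [aI|[x]]; last first.
  by rewrite mem_filter => /andP[xI _] ->.
have /andP[a1 an] := sub _ aI.
exists `|a|%N; last by lia.
rewrite mem_filter mem_index_iota /nat_mem; apply/andP; split; last by lia.
by rewrite (_ : `|a|%N%:Z = a) //; lia.
Qed.

Lemma card_nat_mem (S : {fset int}) (n : nat) : sub_1n S n ->
  #|` S| = (\sum_(0 <= x < n.+1) nat_mem S x)%N.
Proof.
move=> sub; have S0 : ~~ nat_mem S 0 by apply/negP => /sub.
rewrite (perm_size (sub_1n_enum sub)) size_map size_filter big_ltn // (negPf S0) add0n.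
by rewrite -sum1_count big_mkcond /=; apply: eq_bigr => x _; case: (nat_mem S x).
Qed.

(** Both lists are sorted and have the same elements, hence coincide. *)
Lemma elt_nth (S : {fset int}) (n i : nat) : sub_1n S n -> (i < #|` S|)%N ->
  elt S i.+1 = (nth 0%N [seq x <- index_iota 1 n.+1 | nat_mem S x] i)%:Z.
Proof.
move=> sub it; rewrite /elt /=.
have pe := sub_1n_enum sub.
have -> : sort <=%O (enum_fset S) = [seq x%:Z | x <- index_iota 1 n.+1 & nat_mem S x].
  apply: (@sorted_eq _ <=%O); [exact: le_trans|exact: le_anti| | |].
  - by apply: sort_sorted; exact: le_total.
  - rewrite sorted_map; apply: sorted_filter; first by move=> x y z /=; exact: le_trans.
    by apply: (@sub_sorted _ leq); [move=> x y /=; rewrite lez_nat|exact: iota_sorted].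
  - by rewrite perm_sort.
by rewrite (nth_map 0%N) // -(size_map Posz) -(perm_size pe).
Qed.

(** Induction on [n]: a new element [n.+1] is appended at the end of the list, and its rank is the
    new length. *)
Lemma sum_filter_rank (V : nmodType) (chi : pred nat) (F : nat -> nat -> V) (n : nat) :
  ~~ chi 0%N ->
  \sum_(0 <= i < size [seq x <- index_iota 1 n.+1 | chi x])
     F i.+1 (nth 0%N [seq x <- index_iota 1 n.+1 | chi x] i)
  = \sum_(1 <= x < n.+1 | chi x) F (rank chi x) x.
Proof.
move=> chi0; elim: n => [|n IH]; first by rewrite !big_geq.
have iotaS : index_iota 1 n.+2 = rcons (index_iota 1 n.+1) n.+1.
  by rewrite /index_iota !subn1 /= -cats1 -(iotaD 1 n 1) addn1.
have rankE : rank chi n.+1 = (size [seq x <- index_iota 1 n.+1 | chi x] + chi n.+1)%N.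
  rewrite /rank big_ltn // (negPf chi0) add0n big_nat_recr //= size_filter -sum1_count.
  by congr (_ + _)%N; rewrite [RHS]big_mkcond /=; apply: eq_bigr => x _; case: (chi x).
rewrite iotaS big_rcons filter_rcons -IH.
case cn: (chi n.+1) rankE => rankE; last by rewrite Monoid.simpm.
rewrite size_rcons big_nat_recr //= nth_rcons ltnn eqxx rankE addn1; congr (_ + _).
by apply: eq_big_nat => i /andP[_ it]; rewrite nth_rcons it.
Qed.

(** This passes from sums over indices to sums over integers, the form bounded by [sidon_moment]. *)
Lemma sum_elt (V : nmodType) (S : {fset int}) (n : nat) (P : pred int)
    (F : nat -> int -> V) : sub_1n S n ->
  \sum_(1 <= i < #|` S|.+1 | P (elt S i)) F i (elt S i) =
  \sum_(1 <= x < n.+1 | nat_mem S x && P x%:Z) F (rank (nat_mem S) x) x%:Z.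
Proof.
move=> sub; have S0 : ~~ nat_mem S 0 by apply/negP => /sub.
rewrite big_mkcond big_add1 /= big_mkcondr /=.
rewrite -(@sum_filter_rank V (nat_mem S) (fun i x => if P x%:Z then F i x%:Z else 0)) //.
have <- : #|` S| = size [seq x <- index_iota 1 n.+1 | nat_mem S x].
  by rewrite (perm_size (sub_1n_enum sub)) size_map.
by apply: eq_big_nat => i /andP[_ it]; rewrite (elt_nth sub).
Qed.

Lemma int_interval_nat (I : {fset int}) (n : nat) : int_interval I -> sub_1n I n ->
  exists p q : nat, [/\ (0 < p <= q)%N, (q <= n.+1)%N &
    forall x : nat, (x%:Z \in I) = (p <= x < q)%N].
Proof.
move=> [u [v Iuv]] sub; case: (leP u v) => uv; last first.
  (* The empty interval becomes [[1, 1)]. *)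
  by exists 1%N, 1%N; split => // x; rewrite Iuv; lia.
have uI := sub u; have vI := sub v; move: uI vI; rewrite !Iuv uv !lexx /=.
move=> /(_ isT) ? /(_ isT) ?.
exists `|u|%N, `|v|.+1%N; split; [lia|lia|] => x; rewrite Iuv; lia.
Qed.

Lemma eqz_mod_nat (x r m : nat) : (r < m)%N ->
  (x%:Z == r%:Z %[mod m%:Z])%Z = (x %% m == r)%N.
Proof. by move=> rm; rewrite !modz_nat eqz_nat (modn_small rm). Qed.

Lemma sum_nat_restrict (V : nmodType) (P : pred nat) (F : nat -> V) (p q n : nat) :
  (0 < p)%N -> (q <= n.+1)%N ->
  \sum_(1 <= x < n.+1 | P x && (p <= x < q)%N) F x = \sum_(p <= x < q | P x) F x.
Proof.
move=> p0 qn; rewrite (@big_nat_widen _ _ _ p q n.+1) //.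
rewrite (@big_nat_widenl _ _ _ p 1 n.+1) //.
by apply: eq_bigl => x; rewrite andbAC -andbA.
Qed.

End Encoding.

(** * Choice of the constant and derivation of both estimates *)

Theorem theorem4 (R : realType) (m s l : nat) (hm : (1 <= m)%N) :
  exists C : R, 0 < C /\
    forall (r : nat), (r < m)%N ->
    forall (n : nat), (0 < n)%N ->
    forall (S : {fset int}), sub_1n S n -> sidon S ->
    let t := #|` S| in
    let err : R := C * t%:R ^+ s * n%:R ^+ l * Phi R S n * ln (2 * n)%:R in
    (forall I : {fset int}, int_interval I -> sub_1n I n ->
      `| \sum_(1 <= i < t.+1 |
             (elt S i \in I) && (elt S i == r%:Z %[mod m%:Z])%Z)
           i%:R ^+ s * (elt S i)%:~R ^+ l
         - t%:R ^+ s.+1 / n%:R ^+ s.+1 *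
           \sum_(a <- enum_fset I | (a == r%:Z %[mod m%:Z])%Z)
             a%:~R ^+ (s + l) | <= err)
    /\
    `| \sum_(1 <= i < t.+1 | (elt S i == r%:Z %[mod m%:Z])%Z)
         i%:R ^+ s * (elt S i)%:~R ^+ l
       - t%:R ^+ s.+1 / (m%:R * (s + l + 1)%:R) * n%:R ^+ l | <= err.
Proof.
pose K1 : R := 28 * s%:R + 28 * m%:R * 2 ^+ (s + l).
pose K2 : R := 2 ^+ (s + l) + 1.
have K20 : 0 < K2 by rewrite addr_gt0 ?exprn_gt0.
have K10 : 0 <= K1 by rewrite addr_ge0 ?mulr_ge0 ?exprn_ge0.
have ln2 : 0 < ln (2 : R) by rewrite ln_gt0 // ltr1n.
(* [K1] is the moment error, [K2] the power-sum error needed only in (ii), and [ln 2] is the lower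
   bound for [ln (2n)]. None of them involves [r]. *)
exists ((K1 + K2) / ln 2); split; first by rewrite divr_gt0 // ltr_wpDl.
move=> r rm n n0 S Sn sid t err.
set chi := nat_mem S.
have chi0 : ~~ chi 0%N by apply/negP => /Sn.
have chin x : chi x -> (x <= n)%N by move=> /Sn /andP[].
have sidp : sidon_pred chi := sidon_nat_mem sid.
have tE : t = (\sum_(0 <= x < n.+1) chi x)%N := card_nat_mem Sn.
have n0R : (0 : R) < n%:R by rewrite ltr0n.
pose B : R := t%:R ^+ s * n%:R ^+ l * Phit R t n.
have t2 : (t ^ 2 <= 12 * n)%N by rewrite tE sidon_card_sqr.
have [_ [_ P1 _ _ _]] := Phit_window R n0 t2.
have B0 : 0 <= B by rewrite !mulr_ge0 ?exprn_ge0 // (le_trans ler01).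
have errE : (K1 + K2) * B <= err.
  rewrite /err /Phi -/t -/(Phit R t n).
  have -> : (K1 + K2) / ln 2 * t%:R ^+ s * n%:R ^+ l * Phit R t n * ln (2 * n)%:R
     = (K1 + K2) * B * (ln (2 * n)%:R / ln 2) by rewrite /B; ring.
  rewrite ler_peMr ?mulr_ge0 ?addr_ge0 ?(ltW K20) //.
  rewrite ler_pdivlMr // mul1r ler_ln ?posrE ?ltr0n ?muln_gt0 //.
  by rewrite ler_nat; lia.
have moment p q : (0 < p <= q)%N -> (q <= n.+1)%N ->
  `|\sum_(p <= x < q | chi x && (x %% m == r)%N) (rank chi x)%:R ^+ s * x%:R ^+ l
    - t%:R ^+ s.+1 / n%:R ^+ s.+1 *
      \sum_(p <= x < q | (x %% m == r)%N) x%:R ^+ (s + l)| <= K1 * B.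
  move=> pq qn; have := @sidon_moment R chi m r s l n t p q n0 hm sidp chi0 chin tE pq qn.
  congr (`|_ - _ * _| <= _).
    rewrite [RHS]big_mkcond; apply: eq_bigr => x _; rewrite -natrM mulnb andbC.
    by case: (_ && _); rewrite ?mul1r ?mul0r.
  rewrite [RHS]big_mkcond; apply: eq_bigr => x _.
  by case: (_ == _); rewrite ?mul1r ?mul0r.
split.
  move=> I /int_interval_nat /[swap] In /(_ _ In)[p [q [pq qn Ipq]]].
  apply: (le_trans _ errE); apply: (@le_trans _ _ (K1 * B)); last first.
    by rewrite ler_wpM2r // lerDl ltW.
  have := moment p q pq qn; congr (`|_ - _ * _| <= _).
    rewrite (@sum_elt R S n (fun a => (a \in I) && (a == r%:Z %[mod m%:Z])%Z)
      (fun i a => i%:R ^+ s * a%:~R ^+ l) Sn).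
    rewrite -(@sum_nat_restrict _ _ _ p q n) ?(proj1 (andP pq)) //.
    by apply: eq_bigl => x; rewrite Ipq eqz_mod_nat // -andbA [(_ %% _ == _)%N && _]andbC.
  rewrite (perm_big _ (sub_1n_enum In)) big_map big_filter_cond.
  rewrite -(@sum_nat_restrict _ _ _ p q n) ?(proj1 (andP pq)) //.
  by apply: eq_bigl => x; rewrite /nat_mem Ipq eqz_mod_nat // andbC.
apply: (le_trans _ errE); rewrite mulrDl.
rewrite (@sum_elt R S n (fun a => (a == r%:Z %[mod m%:Z])%Z)
  (fun i a => i%:R ^+ s * a%:~R ^+ l) Sn).
under eq_bigl => x do rewrite eqz_mod_nat //.
have M := moment 1%N n.+1 isT (leqnn _).
have N := @sum_pow_residue R m r (s + l) n rm n0.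
set X := \sum_(_ <= _ < _ | _) _; rewrite -/X in M.
set Y := \sum_(_ <= _ < _ | _) _ in M.
have YE : \sum_(1 <= x < n.+1) (x %% m == r)%N%:R * x%:R ^+ (s + l) = Y.
  rewrite /Y [RHS]big_mkcond; apply: eq_bigr => x _.
  by case: (_ == _); rewrite ?mul1r ?mul0r.
rewrite YE in N.
have m0R : (0 : R) < m%:R by rewrite ltr0n.
have k0R : (0 : R) < (s + l).+1%:R by rewrite ltr0n.
have c0 : 0 <= t%:R ^+ s.+1 / n%:R ^+ s.+1 :> R by rewrite divr_ge0 ?exprn_ge0.
(* For (ii), take the moment bound on all of [[1, n]] and then replace the power sum [Y] by its
   leading term. *)
have -> : X - t%:R ^+ s.+1 / (m%:R * (s + l + 1)%:R) * n%:R ^+ l =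
   (X - t%:R ^+ s.+1 / n%:R ^+ s.+1 * Y)
   + t%:R ^+ s.+1 / n%:R ^+ s.+1 * (Y - n%:R ^+ (s + l).+1 / (m%:R * (s + l).+1%:R)).
  rewrite addn1 -addSn [n%:R ^+ (s.+1 + l)]exprD addSn.
  field.
  by rewrite !gt_eqF // exprn_gt0.
apply: (le_trans (ler_normD _ _)); apply: lerD => //.
rewrite normrM (ger0_norm c0); apply: (le_trans (ler_wpM2l c0 N)).
(* The power-sum error carries a spare factor [t / n <= 1], which is at most [Phit R t n] because
   the latter is at least [1]. *)
have tn : (t <= n)%N.
  rewrite tE big_ltn // (negPf chi0) add0n.
  apply: (@leq_trans (\sum_(1 <= i < n.+1) 1)); first by apply: leq_sum => x _; case: (chi x).
  by rewrite sum_nat_const_nat muln1 subn1.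
have tnR : t%:R / n%:R <= 1 :> R by rewrite ler_pdivrMr // mul1r ler_nat.
have -> : t%:R ^+ s.+1 / n%:R ^+ s.+1 * ((2 ^+ (s + l) + 1) * n%:R ^+ (s + l))
   = K2 * (t%:R ^+ s * n%:R ^+ l * (t%:R / n%:R)).
  rewrite /K2 [n%:R ^+ (s + l)]exprD !exprS; field.
  by rewrite !gt_eqF // exprn_gt0.
rewrite ler_pM2l // /B ler_wpM2l ?mulr_ge0 ?exprn_ge0 //.
exact: le_trans P1.
Qed.
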